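(* Let $\mathcal{X}$ be a general state space with a $\sigma$-finite reference measure $\nu$, let $\mu$ be a probability distribution on $\mathcal{X}$ with $\nu$-density $\mu(x)>0$, and let $Q\in\mathcal{S}(\mathcal{X})$ be the generator of a Markov jump process whose off-diagonal transition rates have densities $Q(x,y)$ with respect to $\nu$. For $x\neq y$ put $$M_1(x,y)=\min\Big\{Q(x,y),\tfrac{\mu(y)}{\mu(x)}Q(y,x)\Big\},\qquad M_2(x,y)=\max\Big\{Q(x,y),\tfrac{\mu(y)}{\mu(x)}Q(y,x)\Big\}.$$ Suppose that $$\sup_{x\in\mathcal{X}}\int_{y;\,y\neq x}M_2(x,y)\,\nu(dy)<\infty,$$ so that $M_2$ is the generator of a Markov jump process. Then for every $\alpha\in[0,1]$ the convex combination $\alpha M_1+(1-\alpha)M_2$ minimizes the distance $d_\mu$ between $Q$ and the set $\mathcal{R}(\mu)$ of $\mu$-reversible generators, that is, $$d_\mu(Q,\mathcal{R}(\mu))=d_\mu\big(Q,\alpha M_1+(1-\alpha)M_2\big).$$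
   Context: All generators considered are given by nonnegative (jointly measurable) off-diagonal densities with respect to $\nu$. A function $Q(x,y)\ge 0$, $x\ne y$, defines the generator of a Markov jump process on $\mathcal{X}$ if and only if $\sup_{x\in\mathcal{X}}\int_{y;\,y\neq x}Q(x,y)\,\nu(dy)<\infty$; it then acts on bounded $f$ by $Qf(x)=\int_{y;\,y\ne x}(f(y)-f(x))\,Q(x,y)\,\nu(dy)$. The set of all generators of Markov jump processes on $\mathcal{X}$ is denoted $\mathcal{S}(\mathcal{X})$. $\mathcal{R}(\mu)\subset\mathcal{S}(\mathcal{X})$ is the set of conservative generators $R$ of Markov jump processes that are $\mu$-reversible, i.e. $\mu(x)R(x,y)=\mu(y)R(y,x)$ for $x\neq y$. For $Q_1,Q_2\in\mathcal{S}(\mathcal{X})$, $$d_\mu(Q_1,Q_2):=\int_{\mathcal{X}\times\mathcal{X}\setminus\Delta}\mu(x)\,|Q_1(x,y)-Q_2(x,y)|\,\nu(dx)\,\nu(dy),\qquad \Delta:=\{(x,x):x\in\mathcal{X}\},$$ and $$d_\mu(Q,\mathcal{R}(\mu)):=\inf_{R\in\mathcal{R}(\mu)}d_\mu(Q,R).$$ *)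

(* Defs.v *)
From HB Require Import structures.
From mathcomp Require Import all_boot all_order all_algebra.
From mathcomp Require Import all_classical all_reals all_analysis.

Set Implicit Arguments.
Unset Strict Implicit.
Unset Printing Implicit Defensive.

Import Order.TTheory GRing.Theory Num.Theory.
Import numFieldNormedType.Exports.

Local Open Scope classical_set_scope.
Local Open Scope ring_scope.

(* A generator is represented by its off-diagonal density Q : T -> T -> R with
   respect to nu.  The values Q x x are junk: no definition below reads them. *)

Definition offdiag (T : Type) : set (T * T) := [set z | z.1 <> z.2].
Arguments offdiag : clear implicits.

(* Joint measurability off the diagonal, through the extension by 0 to T * T:
   the integrals over [offdiag T] and [~` [set x]] below are by definition those
   of the extension by 0, so they make sense even if the diagonal of T * T is not
   measurable.  When it is measurable, this is equivalent to measurability of Q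
   on [offdiag T] (measurable_restrict). *)
Definition offdiag_measurable d (T : measurableType d) (R : realType)
    (Q : T -> T -> R) : Prop :=
  measurable_fun setT ((fun z : T * T => Q z.1 z.2) \_ (offdiag T)).

Definition exit_rate d (T : measurableType d) (R : realType)
    (nu : {sigma_finite_measure set T -> \bar R}) (Q : T -> T -> R) (x : T)
    : \bar R :=
  (\int[nu]_(y in ~` [set x]) (Q x y)%:E)%E.

Definition sup_exit_rate d (T : measurableType d) (R : realType)
    (nu : {sigma_finite_measure set T -> \bar R}) (Q : T -> T -> R) : \bar R :=
  ereal_sup (range (exit_rate nu Q)).

Definition generators d (T : measurableType d) (R : realType)
    (nu : {sigma_finite_measure set T -> \bar R}) : set (T -> T -> R) :=
  [set Q | [/\ forall x y, x <> y -> 0 <= Q x y,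
               offdiag_measurable Q
             & (sup_exit_rate nu Q < +oo)%E]].

Definition generator_apply d (T : measurableType d) (R : realType)
    (nu : {sigma_finite_measure set T -> \bar R}) (Q : T -> T -> R)
    (f : T -> R) (x : T) : \bar R :=
  (\int[nu]_(y in ~` [set x]) ((f y - f x) * Q x y)%:E)%E.

(* Q1 = 0.  There is no killing term in [generator_apply], so every generator
   given by an off-diagonal density is conservative. *)
Definition conservative d (T : measurableType d) (R : realType)
    (nu : {sigma_finite_measure set T -> \bar R}) (Q : T -> T -> R) : Prop :=
  forall x, generator_apply nu Q (cst 1) x = 0%E.

Definition reversible_generators d (T : measurableType d) (R : realType)
    (nu : {sigma_finite_measure set T -> \bar R}) (mu : T -> R)
    : set (T -> T -> R) :=
  [set Q | [/\ generators nu Q,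
               conservative nu Q
             & forall x y, x <> y -> mu x * Q x y = mu y * Q y x]].

Definition positive_probability_density d (T : measurableType d) (R : realType)
    (nu : {sigma_finite_measure set T -> \bar R}) (mu : T -> R) : Prop :=
  [/\ measurable_fun setT mu,
      forall x, 0 < mu x
    & (\int[nu]_x (mu x)%:E = 1)%E].

Definition dist_gen d (T : measurableType d) (R : realType)
    (nu : {sigma_finite_measure set T -> \bar R}) (mu : T -> R)
    (Q1 Q2 : T -> T -> R) : \bar R :=
  (\int[nu \x nu]_(z in offdiag T)
     (mu z.1 * `|Q1 z.1 z.2 - Q2 z.1 z.2|)%:E)%E.

Definition dist_gen_set d (T : measurableType d) (R : realType)
    (nu : {sigma_finite_measure set T -> \bar R}) (mu : T -> R)
    (Q : T -> T -> R) (A : set (T -> T -> R)) : \bar R :=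
  ereal_inf [set dist_gen nu mu Q K | K in A].

Definition M1 (T : Type) (R : realType) (mu : T -> R) (Q : T -> T -> R)
    (x y : T) : R :=
  Num.min (Q x y) (mu y / mu x * Q y x).

Definition M2 (T : Type) (R : realType) (mu : T -> R) (Q : T -> T -> R)
    (x y : T) : R :=
  Num.max (Q x y) (mu y / mu x * Q y x).

(* Main.v *)
(** For reversible [R], the flux [r = mu(x) R(x,y)] is symmetric, whereas that of
    [Q] takes the values [a = mu(x) Q(x,y)] and [b = mu(y) Q(y,x)] at [(x,y)] and
    [(y,x)].  Symmetrizing the integral gives
    [2 d(Q,R) = \int (`|a - r| + `|b - r|) >= \int `|a - b|], with equality as
    soon as [r] lies between [a] and [b]; this is the case for
    [alpha M1 + (1 - alpha) M2], whose flux is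
    [alpha min(a,b) + (1 - alpha) max(a,b)]. *)
Require Import Defs.
From mathcomp Require Import all_boot all_order all_algebra.
From mathcomp Require Import all_classical all_reals all_analysis.
From mathcomp Require Import measurable_realfun ring lra.

Set Implicit Arguments.
Unset Strict Implicit.
Unset Printing Implicit Defensive.

Import Order.TTheory GRing.Theory Num.Theory.
Import numFieldNormedType.Exports.

Local Open Scope classical_set_scope.
Local Open Scope ring_scope.

Lemma minr_maxr_ge0 (R : realType) (a b : R) :
  0 <= a -> 0 <= b -> 0 <= Num.min a b <= Num.max a b.
Proof.
move=> a0 b0; rewrite le_min a0 b0 /=.
by rewrite ge_min !le_max lexx.
Qed.

(** Equality case of the triangle inequality: [k] lies on the segment between [a] and [b]. *)
Lemma dist_convex_min_max (R : realType) (a b t : R) : 0 <= t <= 1 ->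
  let k := t * Num.min a b + (1 - t) * Num.max a b in
  `|a - k| + `|b - k| = `|a - b|.
Proof.
move=> /andP[t0 t1] /=.
wlog ab : a b / a <= b.
  move=> H; case/orP: (le_total a b) => [/H //|/H].
  by rewrite minC maxC addrC (distrC a b).
rewrite (min_idPl ab) (max_idPr ab).
have d0 : 0 <= b - a by rewrite subr_ge0.
have -> : a - (t * a + (1 - t) * b) = - ((1 - t) * (b - a)) by ring.
have -> : b - (t * a + (1 - t) * b) = t * (b - a) by ring.
rewrite normrN (distrC a b) !ger0_norm ?mulr_ge0 ?subr_ge0 //; ring.
Qed.

Section Swap.
Context {d : measure_display} {T : measurableType d} {R : realType}.
Variable nu : {sigma_finite_measure set T -> \bar R}.

(** Tonelli: integrating the two variables in either order gives the same value. This is what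
    permits symmetrizing the distance. *)
Lemma ge0_integral_swap (f : T * T -> \bar R) : measurable_fun setT f ->
  (forall z, 0 <= f z)%E ->
  (\int[nu \x nu]_z f (unstable.swap z) = \int[nu \x nu]_z f z)%E.
Proof.
move=> mf f0; rewrite fubini_tonelli1 //.
  by rewrite fubini_tonelli2.
apply: (measurableT_comp mf); exact: measurable_swap.
Qed.

End Swap.

Section Generators.
Context {d : measure_display} {T : measurableType d} {R : realType}.
Variables (nu : {sigma_finite_measure set T -> \bar R}) (mu : T -> R).
Implicit Types Q K : T -> T -> R.

Definition convex_M (alpha : R) Q x y : R :=
  alpha * M1 mu Q x y + (1 - alpha) * M2 mu Q x y.

Lemma offdiag_restrictE (f : T * T -> R) x y :
  (f \_ (offdiag T)) (x, y) = if x == y then 0 else f (x, y).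
Proof.
rewrite patchE; case: eqP => [->|xy].
  by rewrite memNset //= /offdiag /=; apply; reflexivity.
by rewrite mem_set.
Qed.

Lemma restrict_setC1E (f : T -> R) (x y : T) :
  (f \_ (~` [set x])) y = if x == y then 0 else f y.
Proof.
rewrite patchE; case: eqP => [->|xy].
  by rewrite memNset //= => /(_ erefl).
by rewrite mem_set //= => /esym.
Qed.

(** As an integral over all of [T] of a section of the extension by 0, the exit rate gets a
    measurable integrand from joint measurability alone. *)
Lemma exit_rateE Q x :
  exit_rate nu Q x
  = (\int[nu]_y (((fun z => Q z.1 z.2) \_ (offdiag T)) (x, y))%:E)%E.
Proof.
rewrite /exit_rate integral_mkcond -[(fun y => (Q x y)%:E)]/(EFin \o Q x).
rewrite restrict_EFin; apply: eq_integral => y _ /=.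
by rewrite restrict_setC1E offdiag_restrictE.
Qed.

Lemma le_sup_exit_rate Q K : offdiag_measurable Q -> offdiag_measurable K ->
  (forall x y, x <> y -> 0 <= Q x y <= K x y) ->
  (sup_exit_rate nu Q <= sup_exit_rate nu K)%E.
Proof.
move=> mQ mK QK; apply: ge_ereal_sup => _ [x _ <-].
apply: le_trans (ereal_sup_ubound _); last by exists x.
rewrite !exit_rateE; apply: ge0_le_integral => //.
- move=> y _; rewrite lee_fin offdiag_restrictE; case: eqP => // /QK.
  by case/andP.
- by apply/measurable_EFinP; exact: measurable_fun_pair2.
- by apply/measurable_EFinP; exact: measurable_fun_pair2.
- move=> y _; rewrite lee_fin !offdiag_restrictE; case: eqP => // /QK.
  by case/andP.
Qed.

Lemma conservative_generator Q : conservative nu Q.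
Proof.
move=> x; rewrite /generator_apply -[RHS](integral0 nu (~` [set x])).
by apply: eq_integral => y _; rewrite subrr mul0r.
Qed.

Hypotheses (mmu : measurable_fun setT mu) (mu0 : forall x, 0 < mu x).

Lemma offdiag_measurable_convex_M (alpha : R) Q : offdiag_measurable Q ->
  offdiag_measurable (convex_M alpha Q).
Proof.
move=> mQ; rewrite /offdiag_measurable.
set q := (fun z : T * T => Q z.1 z.2) \_ (offdiag T).
(* The swap preserves the off-diagonal set, so [p] is the extension by 0 of the time-reversed
   rate. *)
pose p z := mu z.2 / mu z.1 * q (unstable.swap z).
have mp : measurable_fun setT p.
  apply: measurable_funM; last first.
    apply: (measurableT_comp mQ); exact: measurable_swap.
  apply: measurable_funM; first exact: measurableT_comp mmu measurable_snd.
  (* Since [mu] is positive, its inverse is a real power, and real powers are measurable. *)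
  have -> : (fun z : T * T => (mu z.1)^-1) = (@powR R ^~ (-1)) \o (mu \o fst).
    by apply/funext => z /=; rewrite powR_inv1 // ltW.
  apply: (measurableT_comp (measurable_powR (-1))).
  exact: measurableT_comp mmu measurable_fst.
rewrite [X in measurable_fun _ X](_ : _ = fun z =>
    alpha * Num.min (q z) (p z) + (1 - alpha) * Num.max (q z) (p z)).
  by apply: measurable_funD; apply: measurable_funM => //;
    [exact: measurable_minr|exact: measurable_maxr].
apply/funext => -[x y]; rewrite /p /q /unstable.swap /= !offdiag_restrictE.
rewrite [y == x]eq_sym; case: eqP => // _.
(* Only the diagonal remains, where [q] and [p] both vanish. *)
by rewrite mulr0 minxx maxxx !mulr0 addr0.
Qed.

Definition dist_integrand Q K : T * T -> R :=
  (fun z => mu z.1 * `|Q z.1 z.2 - K z.1 z.2|) \_ (offdiag T).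

Lemma measurable_dist_integrand Q K :
  offdiag_measurable Q -> offdiag_measurable K ->
  measurable_fun setT (dist_integrand Q K).
Proof.
move=> mQ mK.
rewrite [X in measurable_fun _ X](_ : _ = fun z => mu z.1 *
    `|((fun z => Q z.1 z.2) \_ (offdiag T)) z
      - ((fun z => K z.1 z.2) \_ (offdiag T)) z|).
  apply: measurable_funM; first exact: measurableT_comp mmu measurable_fst.
  by apply: measurableT_comp => //; exact: measurable_funB.
apply/funext => -[x y]; rewrite /dist_integrand !offdiag_restrictE /=.
by case: eqP => //; rewrite subrr normr0 mulr0.
Qed.

Lemma dist_integrand_ge0 Q K z : 0 <= dist_integrand Q K z.
Proof.
case: z => x y; rewrite /dist_integrand offdiag_restrictE.
by case: eqP => // _; rewrite mulr_ge0 // ltW.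
Qed.

Lemma dist_gen_double Q K : offdiag_measurable Q -> offdiag_measurable K ->
  (dist_gen nu mu Q K + dist_gen nu mu Q K
   = \int[nu \x nu]_z
      (dist_integrand Q K z + dist_integrand Q K (unstable.swap z))%:E)%E.
Proof.
move=> mQ mK.
have mf : measurable_fun setT (EFin \o dist_integrand Q K).
  by apply/measurable_EFinP; exact: measurable_dist_integrand.
have -> : dist_gen nu mu Q K
    = (\int[nu \x nu]_z (EFin \o dist_integrand Q K) z)%E.
  by rewrite /dist_gen integral_mkcond /dist_integrand -restrict_EFin.
(* Only the second copy of the distance is swapped, so that the sum pairs the values at [(x, y)] and
   [(y, x)]. *)
rewrite -{2}(ge0_integral_swap nu mf); last first.
  by move=> z; rewrite lee_fin dist_integrand_ge0.
rewrite -ge0_integralD //.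
- by move=> z _; rewrite lee_fin dist_integrand_ge0.
- by move=> z _; rewrite lee_fin dist_integrand_ge0.
- apply: (measurableT_comp mf); exact: measurable_swap.
Qed.

Lemma M1_M2_ge0 Q x y : 0 <= Q x y -> 0 <= Q y x ->
  0 <= M1 mu Q x y <= M2 mu Q x y.
Proof.
by move=> Qxy Qyx; apply: minr_maxr_ge0 => //;
  rewrite mulr_ge0 // divr_ge0 // ltW.
Qed.

(** Multiplication by [mu x > 0] commutes with min and max. The right-hand side is visibly symmetric
    in [x] and [y], and has the form handled by [dist_convex_min_max]. *)
Lemma flux_convex_M (alpha : R) Q x y :
  mu x * convex_M alpha Q x y
  = alpha * Num.min (mu x * Q x y) (mu y * Q y x)
    + (1 - alpha) * Num.max (mu x * Q x y) (mu y * Q y x).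
Proof.
have -> : mu y * Q y x = mu x * (mu y / mu x * Q y x).
  by rewrite mulrA mulrCA divff ?mulr1 // gt_eqF.
by rewrite -minr_pMr ?ltW // -maxr_pMr ?ltW // /convex_M /M1 /M2; ring.
Qed.

Lemma reversible_convex_M (alpha : R) Q : 0 <= alpha <= 1 ->
  generators nu Q -> (sup_exit_rate nu (M2 mu Q) < +oo)%E ->
  reversible_generators nu mu (convex_M alpha Q).
Proof.
move=> /andP[a0 a1] [Q0 mQ _] supM2.
set K := convex_M alpha Q.
have mK : offdiag_measurable K by exact: offdiag_measurable_convex_M.
have mM2 : offdiag_measurable (M2 mu Q).
  (* [M2] is the endpoint [alpha = 0] of the family already known to be measurable. *)
  have -> : M2 mu Q = convex_M 0 Q.
    by apply/funext => x; apply/funext => y; rewrite /convex_M; ring.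
  exact: offdiag_measurable_convex_M.
(* From [0 <= M1 <= K <= M2]; this yields both nonnegativity and, by domination, bounded exit
   rates. *)
have KM2 x y : x <> y -> 0 <= K x y <= M2 mu Q x y.
  move=> xy; have /andP[m0 mM] := M1_M2_ge0 (Q0 _ _ xy) (Q0 _ _ (nesym xy)).
  by rewrite /K /convex_M; apply/andP; split; nra.
split.
- split => //; first by move=> x y /KM2 /andP[].
  exact: le_lt_trans (le_sup_exit_rate mK mM2 KM2) supM2.
- exact: conservative_generator.
- by move=> x y _; rewrite /K !flux_convex_M minC maxC.
Qed.

Lemma dist_gen_convex_M_le (alpha : R) Q K : 0 <= alpha <= 1 ->
  offdiag_measurable Q -> reversible_generators nu mu K ->
  (dist_gen nu mu Q (convex_M alpha Q)
   <= dist_gen nu mu Q K)%E.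
Proof.
move=> a01 mQ [[_ mK _] _ revK].
(* The doubled distances can be compared pointwise under the integral. Halving the result is valid
   for infinite values too, so finiteness of the distances does not have to be established first. *)
suff H : forall x y : \bar R, (x + x <= y + y -> x <= y)%E.
  apply: H; rewrite !dist_gen_double //; last first.
    exact: offdiag_measurable_convex_M.
  have mswap L : offdiag_measurable L -> measurable_fun setT
      (fun z => (dist_integrand Q L z
                 + dist_integrand Q L (unstable.swap z))%:E).
    move=> mL; have mf := measurable_dist_integrand mQ mL.
    apply/measurable_EFinP; apply: measurable_funD => //.
    apply: (measurableT_comp mf); exact: measurable_swap.
  apply: ge0_le_integral => //.
  - by move=> z _; rewrite lee_fin addr_ge0 ?dist_integrand_ge0.
  - by apply: mswap; exact: offdiag_measurable_convex_M.
  - exact: mswap.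
  - move=> [x y] _; rewrite lee_fin /dist_integrand /unstable.swap /=.
    rewrite !offdiag_restrictE [y == x]eq_sym; case: eqP => //= xy.
    have normE s r : mu s * `|r| = `|mu s * r| by rewrite normrM gtr0_norm.
    rewrite !normE !mulrBr.
    (* Reversibility replaces the flux of [K] at [(y, x)] by its flux at [(x, y)]: a single number
       [r] is now compared with both fluxes of [Q]. *)
    rewrite !flux_convex_M -(revK _ _ xy).
    rewrite [Num.min (mu y * _) _]minC [Num.max (mu y * _) _]maxC.
    rewrite dist_convex_min_max //.
    (* The left side has collapsed to the distance between the two fluxes of [Q]; the triangle
       inequality through [r] bounds it. *)
    by rewrite [X in _ <= _ + X]distrC ler_distD.
move=> [x| |] [y| |] //=; rewrite ?leNye ?leey // !lee_fin => ?; lra.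
Qed.
End Generators.

Theorem theorem2p1 (d : measure_display) (T : measurableType d) (R : realType)
    (nu : {sigma_finite_measure set T -> \bar R})
    (mu : T -> R) (Hmu : positive_probability_density nu mu)
    (Q : T -> T -> R) (HQ : generators nu Q)
    (HM2 : (sup_exit_rate nu (M2 mu Q) < +oo)%E)
    (alpha : R) (Halpha : 0 <= alpha <= 1) :
  let K := fun x y => alpha * M1 mu Q x y + (1 - alpha) * M2 mu Q x y in
  reversible_generators nu mu K /\
  dist_gen_set nu mu Q (reversible_generators nu mu) = dist_gen nu mu Q K.
Proof.
move=> K; case: Hmu => mmu mu0 _.
(* Membership makes the distance to [K] one of the values in the infimum; the pointwise comparison
   then shows that it is a lower bound of them all. *)
have revK : reversible_generators nu mu K by exact: reversible_convex_M.
split => //; apply/eqP; rewrite eq_le; apply/andP; split.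
  by apply: ereal_inf_lbound; exists K.
case: HQ => _ mQ _; apply: le_ereal_inf_tmp => _ [L revL <-].
exact: dist_gen_convex_M_le.
Qed.
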